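(* Let $R$ be an $\mathcal{A}$-ring. Then every Lucas $R$-module is a strongly Lucas module.
   Context: All rings are commutative with identity. $R$ is an $\mathcal A$-ring (has property $\mathcal A$) if every finitely generated ideal $I$ consisting of zero-divisors ($I\subseteq \mathrm{Z}(R)$) has a nonzero annihilator. An ideal $I$ of $R$ is dense if $(0:_R I)=\{r\in R: Ir=0\}=0$, and semi-regular if it contains a finitely generated dense ideal. $\mathcal{Q}$ denotes the set of finitely generated semi-regular ideals of $R$. An $R$-module $M$ is $\mathcal Q$-torsion-free if $Im=0$ with $I\in\mathcal Q$, $m\in M$ implies $m=0$. A $\mathcal Q$-torsion-free module $M$ is a Lucas module if $\mathrm{Ext}^1_R(R/I,M)=0$ for every $I\in\mathcal Q$, and a strongly Lucas module if $\mathrm{Ext}^n_R(R/I,M)=0$ for every $I\in\mathcal Q$ and every $n\ge1$. *)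

(* Defs.v *)
From HB Require Import structures.
From mathcomp Require Import all_boot all_algebra.
From mathcomp Require Import generic_quotient ring_quotient.
From mathcomp Require Import finmap boolp classical_sets functions cardinality.

Set Implicit Arguments.
Unset Strict Implicit.
Unset Printing Implicit Defensive.

Import GRing.Theory.
Local Open Scope quotient_scope.
Local Open Scope ring_scope.

(* Submodules are the library's [submodClosed V], whose predicates are boolean;
   with the classical axioms of boolp this is no restriction, any Prop-valued
   predicate being turned into a boolean one by `[< _ >]. *)

Section Submodule.
Variables (R : pzRingType) (V : lmodType R) (U : submodClosed V).

Record submod : Type := Submod { submod_val : V; submod_valP : submod_val \in U }.

HB.instance Definition _ := [isSub of submod for submod_val].
HB.instance Definition _ := [Choice of submod by <:].
HB.instance Definition _ := [SubChoice_isSubLmodule of submod by <:].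

End Submodule.

Section QuotientModule.
Variables (R : pzRingType) (V : lmodType R) (U : submodClosed V).

(* [submodClosed] does not inherit from [zmodClosed], because it also covers
   modules over semirings; over a ring, closure under opposites follows. *)
Definition submod_pred : {pred V} := U.

HB.instance Definition _ := GRing.isZmodClosed.Build V submod_pred
  (GRing.submod_closedB (GRing.submodClosedP U)).

Definition quotmod : Type := Quotient.quot submod_pred.

HB.instance Definition _ := GRing.Zmodule.on quotmod.

Definition quotmod_pi (x : V) : quotmod := \pi_(Quotient.quot submod_pred) x.

Lemma quotmod_piP x y : quotmod_pi x = quotmod_pi y <-> x - y \in U.
Proof.
have -> : (x - y \in U) = (quotmod_pi x == quotmod_pi y).
  exact: (Quotient.idealrBE submod_pred).
by split=> /eqP.
Qed.

Lemma quotmod_pi_surj (q : quotmod) : exists x, quotmod_pi x = q.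
Proof. by exists (repr (q : Quotient.quot submod_pred)); exact: reprK. Qed.

Lemma quotmod_piD x y : quotmod_pi (x + y) = quotmod_pi x + quotmod_pi y.
Proof. exact: (Quotient.pi_add submod_pred). Qed.

Definition quotmod_scale (a : R) (q : quotmod) : quotmod :=
  quotmod_pi (a *: repr (q : Quotient.quot submod_pred)).

Lemma quotmod_piZ a x : quotmod_pi (a *: x) = quotmod_scale a (quotmod_pi x).
Proof.
apply/quotmod_piP; rewrite -scalerBr rpredZ //.
by apply/quotmod_piP; rewrite /quotmod_pi reprK.
Qed.

Let scaleA a b q :
  quotmod_scale a (quotmod_scale b q) = quotmod_scale (a * b) q.
Proof.
by have [x <-] := quotmod_pi_surj q; rewrite -!quotmod_piZ scalerA.
Qed.

Let scale1 : left_id 1 quotmod_scale.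
Proof.
by move=> q; have [x <-] := quotmod_pi_surj q; rewrite -quotmod_piZ scale1r.
Qed.

Let scaleDr : right_distributive quotmod_scale +%R.
Proof.
move=> a q r; have [x <-] := quotmod_pi_surj q.
have [y <-] := quotmod_pi_surj r.
by rewrite -quotmod_piD -!quotmod_piZ scalerDr quotmod_piD.
Qed.

Let scaleDl q : {morph quotmod_scale^~ q : a b / a + b}.
Proof.
move=> a b; have [x <-] := quotmod_pi_surj q.
by rewrite -!quotmod_piZ scalerDl quotmod_piD.
Qed.

HB.instance Definition _ :=
  GRing.Zmodule_isLmodule.Build R quotmod scaleA scale1 scaleDr scaleDl.

Lemma quotmod_pi_linear : linear quotmod_pi.
Proof. by move=> a x y; rewrite quotmod_piD quotmod_piZ. Qed.

HB.instance Definition _ :=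
  GRing.isLinear.Build R V quotmod _ quotmod_pi quotmod_pi_linear.

End QuotientModule.

Section KernelImage.
Variables (R : pzRingType) (V W : lmodType R) (f : {linear V -> W}).

Definition kermod : {pred V} := [pred x | f x == 0].

Lemma in_kermod x : (x \in kermod) = (f x == 0).
Proof. by []. Qed.

Lemma kermod_closed : submod_closed kermod.
Proof.
split=> [|a x y]; rewrite !in_kermod; first by rewrite linear0.
by move=> /eqP fx /eqP fy; rewrite linearP fx fy scaler0 addr0.
Qed.

HB.instance Definition _ := GRing.isSubmodClosed.Build R V kermod
  (GRing.submod_closed_semi kermod_closed).

Definition immod : {pred W} := [pred y | `[< exists x, f x = y >]].

Lemma in_immodP y : y \in immod <-> exists x, f x = y.
Proof. by split=> [/asboolP|/asboolP]. Qed.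

Lemma immod_closed : submod_closed immod.
Proof.
split=> [|a y z]; first by apply/in_immodP; exists 0; rewrite linear0.
move=> /in_immodP[x <-] /in_immodP[t <-]; apply/in_immodP.
by exists (a *: x + t); rewrite linearP.
Qed.

HB.instance Definition _ := GRing.isSubmodClosed.Build R W immod
  (GRing.submod_closed_semi immod_closed).

End KernelImage.

Section Preimage.
Variables (R : pzRingType) (V W : lmodType R).
Variables (f : {linear V -> W}) (U : submodClosed W).

Definition premod : {pred V} := [pred x | f x \in U].

Lemma premod_closed : submod_closed premod.
Proof.
have E x : (x \in premod) = (f x \in U) by [].
split=> [|a x y]; rewrite !E; first by rewrite linear0 rpred0.
by move=> Ux Uy; rewrite linearP rpredD // rpredZ.
Qed.

HB.instance Definition _ := GRing.isSubmodClosed.Build R V premod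
  (GRing.submod_closed_semi premod_closed).

End Preimage.

(* Z / (Z cap B); this is the usual Z / B when B is contained in Z. *)
Definition subquot (R : pzRingType) (V : lmodType R) (Z B : submodClosed V) :
    lmodType R :=
  quotmod (premod (\val : {linear submod Z -> V}) B).

Lemma subquot_eq0 (R : pzRingType) (V : lmodType R) (Z B : submodClosed V) :
  (forall x : subquot Z B, x = 0) <-> {subset Z <= B}.
Proof.
split=> [H v Zv|ZB x].
  pose pi := @quotmod_pi R _ (premod (\val : {linear submod Z -> V}) B).
  have /quotmod_piP : pi (Submod Zv) = pi 0 by rewrite [LHS]H [RHS]H.
  by rewrite subr0.
have [[v Zv] <-] := quotmod_pi_surj x.
rewrite -[RHS](raddf0 (@quotmod_pi R _ _)); apply/quotmod_piP.
by rewrite subr0; exact: ZB.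
Qed.

Section FreeModule.
Variables (R : pzRingType) (X : choiceType).

Definition finsupp_pred : {pred X -> R^o} :=
  [pred a | `[< finite_set [set x | a x != 0] >]].

Lemma in_finsuppP a : a \in finsupp_pred <-> finite_set [set x | a x != 0].
Proof. by split=> [/asboolP|/asboolP]. Qed.

Lemma finsupp_closed : submod_closed finsupp_pred.
Proof.
split=> [|c a b].
  apply/in_finsuppP; rewrite (_ : [set _ | _] = set0)%classic //.
  by apply/seteqP; split=> x //=; rewrite eqxx.
move=> /in_finsuppP fa /in_finsuppP fb; apply/in_finsuppP.
apply: (@sub_finite_set _ _
  ([set x | a x != 0] `|` [set x | b x != 0])%classic); last by rewrite finite_setU.
move=> x; have [ax|] := eqVneq (a x) 0; last by left.
by rewrite /= -[(c *: a + b) x]/(c *: a x + b x) ax scaler0 add0r; right.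
Qed.

HB.instance Definition _ := GRing.isSubmodClosed.Build R (X -> R^o) finsupp_pred
  (GRing.submod_closed_semi finsupp_closed).

Definition freemod : lmodType R := submod finsupp_pred.

Definition freecoef (a : freemod) (x : X) : R := \val a x.

Definition freesupp (a : freemod) : {fset X} := fset_set [set x | freecoef a x != 0]%classic.

Lemma freesuppP (a : freemod) x : x \notin freesupp a -> freecoef a x = 0.
Proof.
have /in_finsuppP fa := valP a.
rewrite /freesupp in_fset_set // notin_setE /=.
by move/negP; rewrite negbK => /eqP.
Qed.

Lemma free_basis_subproof (x : X) :
  (fun y => (y == x)%:R : R^o) \in finsupp_pred.
Proof.
apply/in_finsuppP; apply: (@sub_finite_set _ _ [set x]%classic) => //.
by move=> y /=; case: (y =P x) => //; rewrite eqxx.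
Qed.

Definition free_basis (x : X) : freemod := Submod (free_basis_subproof x).

Lemma freecoef_basis x y : freecoef (free_basis x) y = (y == x)%:R.
Proof. by []. Qed.

Variable V : lmodType R.

Definition freelift (h : X -> V) (a : freemod) : V :=
  \sum_(x <- freesupp a) freecoef a x *: h x.

Lemma freeliftE (h : X -> V) (a : freemod) (A : {fset X}) :
  (freesupp a `<=` A)%fset -> freelift h a = \sum_(x <- A) freecoef a x *: h x.
Proof.
move=> sA; apply: big_fset_incl => // x _ /freesuppP ->; exact: scale0r.
Qed.

Lemma freelift_linear h : linear (freelift h).
Proof.
move=> c a b; set A := (freesupp (c *: a + b) `|` freesupp a `|` freesupp b)%fset.
rewrite (@freeliftE h (c *: a + b) A) ?(@freeliftE h a A) ?(@freeliftE h b A).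
- rewrite scaler_sumr -big_split /=; apply: eq_bigr => x _.
  by rewrite [X in X *: _]/(c * freecoef a x + freecoef b x) scalerDl scalerA.
- by apply/fsubsetP => x; rewrite !inE => ->; rewrite !orbT.
- by apply/fsubsetP => x; rewrite !inE => ->; rewrite !orbT.
- by apply/fsubsetP => x; rewrite !inE => ->.
Qed.

HB.instance Definition _ h := GRing.isLinear.Build R freemod V _ (freelift h)
  (freelift_linear h).

Lemma freelift_basis h x : freelift h (free_basis x) = h x.
Proof.
rewrite (@freeliftE h _ [fset x]%fset).
  by rewrite big_seq_fset1 freecoef_basis eqxx scale1r.
apply/fsubsetP => y; rewrite inE; apply: contraLR => /negPf yx.
rewrite /freesupp in_fset_set; last exact/in_finsuppP/(valP (free_basis x)).
by rewrite notin_setE /= freecoef_basis yx eqxx.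
Qed.

Lemma free_decomp (a : freemod) : a = \sum_(x <- freesupp a) freecoef a x *: free_basis x.
Proof.
apply: val_inj; apply/funext => y; rewrite -[LHS]/(freecoef a y) -[RHS]/(freecoef _ y).
have fD : {morph freecoef^~ y : b c / b + c} by [].
have f0 : freecoef 0 y = 0 by [].
rewrite (big_morph (freecoef^~ y) fD f0).
have E x : freecoef (freecoef a x *: free_basis x) y = freecoef a x * (y == x)%:R.
  by [].
under eq_bigr do rewrite E.
have [ya|ya] := boolP (y \in freesupp a); last first.
  rewrite (freesuppP ya) big_seq big1 // => x xa.
  by case: eqP ya => [->|_ _]; rewrite ?xa // mulr0.
rewrite (big_fsetD1 y) //= eqxx mulr1 big_seq big1 ?addr0 // => x.
by rewrite !inE eq_sym => /andP[/negPf -> _]; rewrite mulr0.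
Qed.

Lemma freelift_unique (f : {linear freemod -> V}) a :
  f a = freelift (f \o free_basis) a.
Proof.
rewrite {1}[a]free_decomp linear_sum; apply: eq_bigr => x _.
by rewrite linearZ.
Qed.

End FreeModule.

Section Resolution.
Variable R : pzRingType.

Definition projective (P : lmodType R) : Prop :=
  forall (V W : lmodType R) (g : {linear V -> W}) (f : {linear P -> W}),
    (forall w, exists v, g v = w) ->
    exists h : {linear P -> V}, forall x, g (h x) = f x.

Record resolution (N : lmodType R) := Resolution {
  res_mod : nat -> lmodType R;
  res_d : forall n, {linear res_mod n.+1 -> res_mod n};
  res_aug : {linear res_mod 0%N -> N};
  res_proj : forall n, projective (res_mod n);
  res_aug_surj : forall y, exists x, res_aug x = y;
  res_exact0 : forall x, res_aug x = 0 <-> exists y, res_d 0 y = x;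
  res_exact : forall n x, res_d n x = 0 <-> exists y, res_d n.+1 y = x
}.

Lemma freemod_projective (X : choiceType) : projective (freemod R X).
Proof.
move=> V W g f gsurj.
have /choice[s sP] : forall x, exists v, g v = f (free_basis R x) by move=> x.
exists (freelift s) => a.
rewrite [RHS]freelift_unique linear_sum /=; apply: eq_bigr => x _.
by rewrite linearZ /= sP.
Qed.

Variable N : lmodType R.

Definition free_cover (V : lmodType R) : {linear freemod R V -> V} :=
  freelift (@idfun V).

Lemma free_cover_surj (V : lmodType R) y : exists x, free_cover V x = y.
Proof. by exists (free_basis R y); rewrite /free_cover /= freelift_basis. Qed.

Fixpoint syzygy (n : nat) : lmodType R :=
  if n is m.+1 then submod (kermod (free_cover (syzygy m))) else N.

Definition free_d (n : nat) :
    {linear freemod R (syzygy n.+1) -> freemod R (syzygy n)} :=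
  (\val : {linear syzygy n.+1 -> freemod R (syzygy n)}) \o free_cover (syzygy n.+1).

Lemma free_dP n x : free_cover (syzygy n) x = 0 <-> exists y, free_d n y = x.
Proof.
split=> [x0|[y <-]].
  have kx : x \in kermod (free_cover (syzygy n)) by rewrite in_kermod x0.
  by have [y yP] := free_cover_surj (Submod kx : syzygy n.+1); exists y; rewrite /free_d /= yP.
by apply/eqP; exact: (valP (free_cover (syzygy n.+1) y)).
Qed.

Lemma free_exact n x : free_d n x = 0 <-> exists y, free_d n.+1 y = x.
Proof.
have v0 := raddf0 (\val : {linear syzygy n.+1 -> freemod R (syzygy n)}).
rewrite -free_dP /free_d /=; split=> [x0|->]; last exact: v0.
by apply: val_inj; rewrite v0.
Qed.

Definition free_resolution : resolution N :=
  @Resolution N (fun n => freemod R (syzygy n)) free_d (free_cover N)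
    (fun n => @freemod_projective (syzygy n)) (@free_cover_surj N) (@free_dP 0)
    free_exact.

End Resolution.

Section Hom.
Variables (R : comPzRingType) (V W : lmodType R).

(* Commutativity of R is what makes Hom_R(V, W) closed under scaling. *)
Definition hom_pred : {pred V -> W} := [pred f | `[< linear f >]].

Lemma in_homP f : f \in hom_pred <-> linear f.
Proof. by split=> [/asboolP|/asboolP]. Qed.

Lemma hom_closed : submod_closed hom_pred.
Proof.
split=> [|c f g].
  by apply/in_homP => a x y; rewrite /GRing.zero /= scaler0 addr0.
move=> /in_homP fl /in_homP gl; apply/in_homP => a x y.
rewrite -[LHS]/(c *: f (a *: x + y) + g (a *: x + y)) fl gl.
rewrite -[(c *: f + g) x]/(c *: f x + g x) -[(c *: f + g) y]/(c *: f y + g y).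
by rewrite !scalerDr !scalerA (mulrC c) addrACA.
Qed.

HB.instance Definition _ := GRing.isSubmodClosed.Build R (V -> W) hom_pred
  (GRing.submod_closed_semi hom_closed).

Definition hom : lmodType R := submod hom_pred.

Lemma hom_linear (f : hom) : linear (\val f).
Proof. exact/in_homP/(valP f). Qed.

End Hom.

Section Precomp.
Variables (R : comPzRingType) (U V W : lmodType R) (d : {linear U -> V}).

Lemma precomp_subproof (f : hom V W) : \val f \o d \in @hom_pred R U W.
Proof. by apply/in_homP => a x y /=; rewrite linearP hom_linear. Qed.

Definition precomp (f : hom V W) : hom U W := Submod (precomp_subproof f).

Lemma precomp_linear : linear precomp.
Proof. by move=> a f g; apply: val_inj. Qed.

HB.instance Definition _ := GRing.isLinear.Build R (hom V W) (hom U W) _ precomp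
  precomp_linear.

End Precomp.

Section Ext.
Variables (R : comPzRingType) (N M : lmodType R).

Section Cohomology.
Variable P : resolution N.

Definition cocycles (n : nat) : submodClosed (hom (res_mod P n) M) :=
  kermod (precomp (W := M) (res_d P n)).

(* In degree 0 nothing maps into Hom(P_0, M): the coboundaries are zero. *)
Definition coboundaries (n : nat) : submodClosed (hom (res_mod P n) M) :=
  match n with
  | 0 => kermod (idfun : {linear hom (res_mod P 0) M -> hom (res_mod P 0) M})
  | m.+1 => immod (precomp (W := M) (res_d P m))
  end.

(* The n-th cohomology module of the complex Hom_R(P, M), where P is the deleted
   resolution: Hom(P_0, M) -> Hom(P_1, M) -> Hom(P_2, M) -> ... *)
Definition cohomology (n : nat) : lmodType R :=
  subquot (cocycles n) (coboundaries n).

Lemma cohomology_eq0 (n : nat) :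
  (forall x : cohomology n.+1, x = 0) <->
  (forall f : {linear res_mod P n.+1 -> M}, (forall x, f (res_d P n.+1 x) = 0) ->
     exists g : {linear res_mod P n -> M}, forall x, g (res_d P n x) = f x).
Proof.
have linearI (U : lmodType R) (f : hom U M) : exists g : {linear U -> M}, \val f = g.
  pose L := GRing.isLinear.Build R U M _ (\val f) (hom_linear f).
  by exists (HB.pack_for {linear U -> M} (\val f) L).
have homI (U : lmodType R) (g : {linear U -> M}) : exists f : hom U M, \val f = g.
  have gl : (g : U -> M) \in @hom_pred R U M by apply/in_homP; exact: linearP.
  by exists (Submod gl).
rewrite subquot_eq0; split=> [H f fd|H f].
  have [f' f'E] := homI _ f.
  have /H/in_immodP[g' /(congr1 val)/= g'E] : f' \in cocycles n.+1.
    by rewrite in_kermod; apply/eqP/val_inj/funext => x; rewrite /= f'E fd.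
  have [g gE] := linearI _ g'; exists g => x.
  by rewrite -f'E -gE; exact: (congr1 (@^~ x) g'E).
rewrite in_kermod => /eqP/(congr1 val)/= fd; apply/in_immodP.
have [f' f'E] := linearI _ f.
have [x|g' g'E] := H f'; first by rewrite -f'E; exact: (congr1 (@^~ x) fd).
have [g gE] := homI _ g'; exists g.
by apply/val_inj/funext => x; rewrite /= gE f'E g'E.
Qed.

End Cohomology.

(* Ext^n_R(N, M), computed from the standard free resolution of N. *)
Definition Ext (n : nat) : lmodType R := cohomology (free_resolution N) n.

End Ext.

Section LucasModules.
Variable R : comPzRingType.

(* Not the library's [idealr], which only covers proper ideals of nonzero rings. *)
Definition ideal : Type := submodClosed R^o.
Identity Coercion ideal_to_submodClosed : ideal >-> submodClosed.

Implicit Types I J : ideal.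

Definition fin_gen I : Prop :=
  exists (n : nat) (a : 'I_n -> R),
    forall x : R, x \in I <-> exists c : 'I_n -> R, x = \sum_(i < n) c i * a i.

Definition zero_divisor (x : R) : Prop := exists y : R, y != 0 /\ x * y = 0.

(* r belongs to the annihilator (0 : I). *)
Definition annihilates I (r : R) : Prop := forall x : R, x \in I -> x * r = 0.

Definition A_ring : Prop :=
  forall I, fin_gen I -> (forall x : R, x \in I -> zero_divisor x) ->
    exists r : R, r != 0 /\ annihilates I r.

Definition dense I : Prop := forall r : R, annihilates I r -> r = 0.

Definition semi_regular I : Prop :=
  exists J, {subset J <= I} /\ fin_gen J /\ dense J.

Definition inQ I : Prop := fin_gen I /\ semi_regular I.

Definition quot_by I : lmodType R := quotmod I.

Definition Q_torsion_free (M : lmodType R) : Prop :=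
  forall I (m : M), inQ I -> (forall x : R, x \in I -> x *: m = 0) -> m = 0.

Definition Lucas (M : lmodType R) : Prop :=
  Q_torsion_free M /\
  forall I, inQ I -> forall e : Ext (quot_by I) M 1, e = 0.

Definition strongly_Lucas (M : lmodType R) : Prop :=
  Q_torsion_free M /\
  forall I, inQ I -> forall n : nat, (1 <= n)%N ->
    forall e : Ext (quot_by I) M n, e = 0.

End LucasModules.

(* Main.v *)
(** In an A-ring a finitely generated dense ideal I contains a non-zero-divisor s.
    The principal ideal (s) is again in Q, so a Lucas module M is s-torsion-free
    and Ext^1(R/(s), M) = M/sM vanishes: s acts bijectively on M, hence on every
    Ext^n(R/I, M).  But s kills R/I, so it also acts as zero on Ext^n(R/I, M),
    because multiplication by s is null-homotopic on a projective resolution of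
    R/I. *)
Require Import Defs.
From HB Require Import structures.
From mathcomp Require Import all_boot all_algebra.
From mathcomp Require Import boolp.

Set Implicit Arguments.
Unset Strict Implicit.
Unset Printing Implicit Defensive.

Import GRing.Theory.
Local Open Scope ring_scope.

(** [projective] only lifts along surjections, so [g] and [f] are first corestricted to the image of
    [g]. *)
Lemma projective_lift (R : pzRingType) (P V W : lmodType R)
    (g : {linear V -> W}) (f : {linear P -> W}) :
    projective P -> (forall x, exists v, g v = f x) ->
  exists h : {linear P -> V}, forall x, g (h x) = f x.
Proof.
move=> projP fg.
pose im := submod (immod g).
have gim v : g v \in immod g by apply/in_immodP; exists v.
have fim x : f x \in immod g by exact/in_immodP/fg.
pose g' (v : V) : im := Submod (gim v).
pose f' (x : P) : im := Submod (fim x).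
have g'L : linear g' by move=> a x y; apply: val_inj; exact: linearP.
have f'L : linear f' by move=> a x y; apply: val_inj; exact: linearP.
pose Lg := GRing.isLinear.Build R V im _ g' g'L.
pose Lf := GRing.isLinear.Build R P im _ f' f'L.
have [|h hP] := projP _ _ (HB.pack_for {linear V -> im} g' Lg)
                          (HB.pack_for {linear P -> im} f' Lf).
  move=> [w wim]; have /in_immodP[v vw] := wim.
  by exists v; apply: val_inj.
by exists h => x; exact: (congr1 val (hP x)).
Qed.

Section AnnihilatedByScalar.
Variables (R : comPzRingType) (N : lmodType R) (P : resolution N) (s : R).
Hypothesis sN : forall y : N, s *: y = 0.

Lemma res_dd_eq0 n (x : res_mod P n.+2) : res_d P n (res_d P n.+1 x) = 0.
Proof. by apply/res_exact; exists x. Qed.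

Lemma scale_null_homotopic n :
  exists (h : {linear res_mod P n -> res_mod P n.+1})
         (k : {linear res_mod P n.+1 -> res_mod P n.+2}),
    forall x, res_d P n.+1 (k x) + h (res_d P n x) = s *: x.
Proof.
(* The hypothesis says that [s *: x - h (d x)] is a cycle. By exactness it is a boundary, so
   projectivity lifts it to [k]. *)
have step m (h : {linear res_mod P m -> res_mod P m.+1}) :
    (forall x, res_d P m (h (res_d P m x)) = s *: res_d P m x) ->
    exists k : {linear res_mod P m.+1 -> res_mod P m.+2},
      forall x, res_d P m.+1 (k x) + h (res_d P m x) = s *: x.
  move=> hP.
  have [|k kP] := @projective_lift _ _ _ _ (res_d P m.+1)
    ((s \*: idfun) \- (h \o res_d P m)) (@res_proj _ _ P m.+1).
    by move=> x; apply/res_exact; rewrite /= linearB linearZ hP subrr.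
  by exists k => x; rewrite kP /= subrK.
elim: n => [|n [h [k hk]]].
  have [|h hP] := @projective_lift _ _ _ _ (res_d P 0) (s \*: idfun) (@res_proj _ _ P 0).
    by move=> x; apply/res_exact0; rewrite /= linearZ /= sN.
  by exists h; apply: step => x; exact: hP.
exists k; apply: step => x.
(* On a boundary the [h] term of the homotopy identity vanishes, since d d = 0. *)
by have := hk (res_d P n.+1 x); rewrite res_dd_eq0 linear0 addr0.
Qed.

(** A cocycle [f] kills d k, so the homotopy gives s f = f h d. Lifting [f \o h] through
    multiplication by [s] gives [g] with s g = f h; then s (g d - f) = 0, and injectivity yields g d
    = f. *)
Lemma cohomology_scale_bijective_eq0 (M : lmodType R) n :
    (forall m : M, s *: m = 0 -> m = 0) -> (forall m : M, exists m', s *: m' = m) ->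
  forall e : cohomology M P n.+1, e = 0.
Proof.
move=> sinj ssurj; apply/cohomology_eq0 => f fd.
have [h [k hk]] := scale_null_homotopic n.
have [|g gP] := @projective_lift _ _ _ _ (s \*: idfun : {linear M -> M})
  (f \o h) (@res_proj _ _ P n); first by move=> x; exact: ssurj.
exists g => x; apply/eqP; rewrite -subr_eq0; apply/eqP/sinj.
have /= gdx := gP (res_d P n x).
by rewrite scalerBr gdx -linearZ -hk linearD fd add0r subrr.
Qed.

End AnnihilatedByScalar.

Section Principal.
Variables (R : comPzRingType) (s : R).

Definition principal : ideal R := immod (s \*: idfun : {linear R^o -> R^o}).

Lemma in_principalP (x : R) : x \in principal <-> exists t : R, s * t = x.
Proof. exact: in_immodP. Qed.

Hypothesis s_regular : forall y : R, s * y = 0 -> y = 0.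

Lemma principal_inQ : inQ principal.
Proof.
have fgs : fin_gen principal.
  exists 1, (fun=> s) => x; rewrite in_principalP; split=> [[t <-]|[c ->]].
    by exists (fun=> t); rewrite big_ord1 mulrC.
  by exists (c ord0); rewrite big_ord1 mulrC.
split=> //; exists principal; split=> //; split=> // r rs.
by apply/s_regular/rs/in_principalP; exists 1; rewrite mulr1.
Qed.

(* [phi0, phi1] is a comparison map from P to the resolution 0 -> R -s-> R of R/(s). *)
Lemma cohomology1_principal_divisible (P : resolution (quot_by principal))
    (M : lmodType R) :
    (forall e : cohomology M P 1, e = 0) -> forall m : M, exists m', s *: m' = m.
Proof.
move=> /cohomology_eq0 ext1 m.
pose pi : {linear R^o -> quot_by principal} := @quotmod_pi R R^o principal.
have pi0 t : pi t = 0 <-> exists u, s * u = t.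
  by rewrite -(linear0 pi) -in_principalP -{2}[t]subr0; exact: quotmod_piP.
have [|phi0 phi0P] := @projective_lift _ _ _ _ pi (res_aug P) (@res_proj _ _ P 0).
  by move=> x; exact: quotmod_pi_surj.
have [|phi1 phi1P] := @projective_lift _ _ _ _ (s \*: idfun : {linear R^o -> R^o})
    (phi0 \o res_d P 0) (@res_proj _ _ P 1).
  by move=> x; apply/pi0; rewrite phi0P; apply/res_exact0; exists x.
(* The pullback along [phi1] of the map R -> M sending 1 to [m]; it is a cocycle because s phi1 d =
   phi0 d d = 0 and [s] is regular. *)
pose f x : M := (phi1 x : R) *: m.
have fL : linear f.
  by move=> a x y; rewrite /f linearP scalerDl scalerA.
pose L := GRing.isLinear.Build R (res_mod P 1) M _ f fL.
have [x|g gP] := ext1 (HB.pack_for {linear res_mod P 1 -> M} f L).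
  rewrite /= /f (_ : phi1 _ = 0) ?scale0r //; apply: s_regular.
  by rewrite [LHS]phi1P /= res_dd_eq0 linear0.
(* With [u] over the class of 1 and d y = s u, [phi1 y = phi0 u = 1 + s * t]. Evaluating g d = f at
   [y] gives s g(u) = m + s t m. *)
have [u uP] := res_aug_surj P (pi 1).
have [y yP] : exists y, res_d P 0 y = s *: u.
  apply/res_exact0; rewrite linearZ uP -linearZ; apply/pi0.
  by exists 1.
have [t tP] : exists t, s * t = phi0 u - 1.
  by apply/pi0; rewrite linearB phi0P uP subrr.
have phi1y : phi1 y = phi0 u.
  apply/eqP; rewrite -subr_eq0; apply/eqP/s_regular; rewrite mulrBr.
  by rewrite [s * phi1 y]phi1P /= yP linearZ subrr.
exists (g u - t *: m).
have := gP y; rewrite yP linearZ /= /f phi1y => sgu.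
by rewrite scalerBr sgu scalerA tP -scalerBl opprB addrC subrK scale1r.
Qed.

End Principal.

(** Otherwise I consists of zero-divisors, and a nonzero annihilator of I would also annihilate the
    dense ideal J inside I. *)
Lemma A_ring_inQ_regular (R : comPzRingType) (I : ideal R) :
  A_ring R -> inQ I -> exists2 s : R, s \in I & forall y : R, s * y = 0 -> y = 0.
Proof.
move=> hR [fgI [J [JI [_ denseJ]]]]; apply: contrapT => noreg.
have [x xI|r [/eqP r0 annr]] := hR I fgI.
  apply: contrapT => xreg; apply: noreg; exists x => // y xy0.
  by apply: contrapT => /eqP y0; apply: xreg; exists y.
by apply/r0/denseJ => x /JI; exact: annr.
Qed.

Theorem theorem2p5 (R : comPzRingType) (hR : A_ring R) (M : lmodType R)
  (hM : Lucas M) : strongly_Lucas M.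
Proof.
have [tfM ext1] := hM; split=> // I QI [//|n] _.
have [s sI s_regular] := A_ring_inQ_regular hR QI.
have Qs := principal_inQ s_regular.
(* Remaining: [s] kills R/I because [s] is in I, and acts injectively and surjectively on M because
   (s) is in Q. *)
apply: (@cohomology_scale_bijective_eq0 _ _ _ s).
- move=> q; have [x <-] := quotmod_pi_surj q; rewrite -linearZ -(linear0 (@quotmod_pi R R^o I)).
  by apply/quotmod_piP; rewrite subr0 [_ *: _]mulrC; exact: rpredZ.
- move=> m sm; apply: (tfM _ m Qs) => x /in_principalP[t <-].
  by rewrite mulrC -scalerA sm scaler0.
- exact: (cohomology1_principal_divisible s_regular (ext1 _ Qs)).
Qed.
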